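(* Let $G$ be a $d$-dimensional simplicial complex and let $(F,R)$ be a rooted forest of $G$. For any linear ordering $\alpha$ of $\overline{R}$ and any linear ordering $\beta$ of $F$, $$\sum_{\phi\text{ fitting orientation of }(F,R)}\Lambda_{\alpha,\beta}(\phi)=|H_{d-1}(F,R)|.$$ Moreover, for every fitting orientation $\phi$ of $(F,R)$, $\Lambda_{\alpha,\beta}(\phi)\in\{-1,1\}$ does not depend on $(\alpha,\beta)$.
   Context: A simplicial complex on $n$ vertices is a nonempty collection $G$ of subsets of $[n]=\{1,\dots,n\}$ closed under taking subsets; its elements are called faces. A $k$-face is a face of cardinality $k+1$ (so $\emptyset$ is the $(-1)$-face), $G_k$ is the set of $k$-faces, and the dimension $d\ge 0$ of $G$ is the maximal dimension of its faces. Incidence matrix: for $k\ge 0$, $\partial_k^{G}$ is the matrix with rows indexed by $G_{k-1}$ and columns indexed by $G_k$ whose entry $\partial_k^{G}[r,f]$ is $(-1)^j$ if $f=\{v_0,\dots,v_k\}$ with $v_0<\cdots<v_k$ and $r=f\setminus\{v_j\}$, and $0$ if $r\not\subset f$. It is also viewed as the boundary map sending combinations of $k$-faces to combinations of $(k-1)$-faces. A subset $F\subseteq G_d$ is a forest of $G$ if the columns of $\partial_d^{G}$ indexed by $F$ are linearly independent (over $\mathbb{R}$). For $R\subseteq G_{d-1}$ write $\overline{R}=G_{d-1}\setminus R$. For a forest $F$, let $\partial_d^{F}$ be the submatrix of $\partial_d^{G}$ with columns indexed by $F$ and all rows indexed by $G_{d-1}$; $R$ is a root of $F$ if the rows of $\partial_d^{F}$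 indexed by $\overline{R}$ form a basis of the row space of $\partial_d^{F}$. A rooted forest of $G$ is a pair $(F,R)$ where $F\subseteq G_d$ is a forest of $G$ (possibly empty) and $R\subseteq G_{d-1}$ is a root of $F$. In this case $|F|=|\overline{R}|$ and the submatrix $\partial_{\overline{R},F}$ of $\partial_d^{G}$ with rows $\overline{R}$ and columns $F$ has nonzero determinant. Relative homology: for $F\subseteq G_d$ and $R\subseteq G_{d-1}$, let $\Psi_{F,R}:\mathbb{Z}F\to \mathbb{Z}G_{d-1}/\mathbb{Z}R$ be the group homomorphism $x\mapsto \partial_d^{G}(x)+\mathbb{Z}R$, where $\mathbb{Z}S$ denotes the free abelian group on a set $S$. Then $H_{d-1}(F,R)=\operatorname{coker}\Psi_{F,R}=(\mathbb{Z}G_{d-1}/\mathbb{Z}R)/\operatorname{Im}(\Psi_{F,R})$, and $|H_{d-1}(F,R)|$ is its cardinality. A fitting orientation of a rooted forest $(F,R)$ is a bijection $\phi:\overline{R}\to F$ such that $r\subset\phi(r)$ for every $r\in\overline{R}$. Signs: let $m=|F|=|\overline{R}|$, let $\alpha$ be a linear ordering of $\overline{R}$ and $\beta$ a linear ordering of $F$. For a bijection $\phi:\overline{R}\to F$ let $\pi_{\alpha,\beta,\phi}\in S_m$ be the permutation such that $\phi$ maps the $i$th face of $\overline{R}$ (in the order $\alpha$) to the $\pi_{\alpha,\beta,\phi}(i)$th face of $F$ (in the order $\beta$). For a fitting orientation $\phi$ put $$\lambda_{\alpha,\beta}(\phi)=\operatorname{sign}(\pi_{\alpha,\beta,\phi})\prod_{r\in\overline{R}}\partial_d^{G}[r,\phi(r)].$$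 Let $\operatorname{sign}(\alpha,\beta)\in\{-1,1\}$ be the sign of the determinant of the matrix obtained from $\partial_{\overline{R},F}$ by ordering its rows according to $\alpha$ and its columns according to $\beta$. The sign of $\phi$ is $\Lambda_{\alpha,\beta}(\phi)=\operatorname{sign}(\alpha,\beta)\cdot\lambda_{\alpha,\beta}(\phi)$. *)

(* Defs.v *)
From HB Require Import structures.
From mathcomp Require Import boolp classical_sets functions cardinality reals.
From mathcomp Require Import all_boot all_order all_fingroup all_algebra.
From mathcomp Require Import generic_quotient.

Set Implicit Arguments.
Unset Strict Implicit.
Unset Printing Implicit Defensive.

Import GRing.Theory Num.Theory.
Local Open Scope ring_scope.
Local Open Scope quotient_scope.

Section SimplicialComplex.
Variable n : nat.
Notation face := {set 'I_n}.
Implicit Types (G S A B F R : {set face}) (d : nat).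

Definition simplicial_complex G : Prop :=
  G != set0 /\ (forall f g : face, f \in G -> g \subset f -> g \in G).

(* Indexed by cardinality, not dimension, so that the (-1)-face is covered:
   G_d is [faces G d.+1] and G_(d-1) is [faces G d], also when d = 0. *)
Definition faces G (c : nat) : {set face} := [set f in G | #|f| == c].

Definition has_dimension G d : Prop := (\max_(f in G) #|f| = d.+1)%N.

(* The entry of the incidence matrix; the vertex v = v_j of
   f = {v_0 < ... < v_k} with r = f \ {v_j} is unique if it exists, and j is
   the number of vertices of f below it. *)
Definition incidence (r f : face) : int :=
  if [pick v in f | r == f :\ v] is Some v
  then (-1) ^+ #|[set u in f | (u < v)%N]| else 0.

(* The block of the incidence matrix with rows A and columns B, each listed
   in the order of [enum]. *)
Definition bdmx A B : 'M[int]_(#|A|, #|B|) :=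
  \matrix_(i, j) incidence (enum_val i) (enum_val j).

(* The columns are independent over K: the rows of the transpose are free. *)
Definition forest (K : realType) G d F : Prop :=
  F \subset faces G d.+1 /\
  row_free (map_mx intr (bdmx (faces G d) F) : 'M[K]__)^T.

Definition coroot G d R : {set face} := faces G d :\: R.

(* The rows indexed by the complement of R form a basis of the row space. *)
Definition is_root (K : realType) G d F R : Prop :=
  let M A : 'M[K]_(#|A|, #|F|) := map_mx intr (bdmx A F) in
  [/\ R \subset faces G d,
      row_free (M (coroot G d R)) &
      (M (coroot G d R) == M (faces G d))%MS].

Definition rooted_forest (K : realType) G d F R : Prop :=
  forest K G d F /\ is_root K G d F R.

Definition chain S := {ffun {s : face | s \in S} -> int}.

Definition boundary A B (x : chain B) : chain A :=
  [ffun r => \sum_(f : {f : face | f \in B}) x f * incidence (val r) (val f)].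

Lemma boundary_is_zmod_morphism A B : zmod_morphism (@boundary A B).
Proof.
move=> x y; apply/ffunP => r; rewrite !ffunE -sumrB.
by apply: eq_bigr => f _; rewrite !ffunE mulrBl.
Qed.

HB.instance Definition _ A B :=
  GRing.isZmodMorphism.Build (chain B) (chain A) (@boundary A B)
    (@boundary_is_zmod_morphism A B).

(* The copy of Z(R) inside Z(S), for R a subset of S. *)
Definition subchain S R : pred (chain S) :=
  fun x => [forall s, (val s \notin R) ==> (x s == 0)].

Lemma subchain_zmod_closed S R : zmod_closed (subchain (S := S) R).
Proof.
split; first by apply/forallP => s; rewrite ffunE eqxx implybT.
move=> x y /forallP hx /forallP hy; apply/forallP => s; apply/implyP => sR.
by rewrite !ffunE (eqP (implyP (hx s) sR)) (eqP (implyP (hy s) sR)) subrr.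
Qed.

HB.instance Definition _ S R :=
  GRing.isZmodClosed.Build (chain S) (subchain (S := S) R)
    (@subchain_zmod_closed S R).

End SimplicialComplex.

Definition im_pred (U V : zmodType) (h : {additive U -> V}) : pred V :=
  fun y => `[< exists x, y = h x >].

Lemma im_pred_zmod_closed (U V : zmodType) (h : {additive U -> V}) :
  zmod_closed (im_pred h).
Proof.
split; first by apply/asboolP; exists 0; rewrite raddf0.
move=> _ _ /asboolP[x ->] /asboolP[y ->]; apply/asboolP.
by exists (x - y); rewrite raddfB.
Qed.

HB.instance Definition _ (U V : zmodType) (h : {additive U -> V}) :=
  GRing.isZmodClosed.Build V (im_pred h) (im_pred_zmod_closed h).

Definition coker (U V : zmodType) (h : {additive U -> V}) : zmodType :=
  {ideal_quot (GRing.ZmodClosed.clone V (im_pred h) _)}.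

Section Homology.
Variable n : nat.
Notation face := {set 'I_n}.
Implicit Types (G F R : {set face}) (d : nat).

Definition relchain G d R : zmodType :=
  {ideal_quot (GRing.ZmodClosed.clone _ (subchain (S := faces G d) R) _)}.

Definition Psi G d F R : {additive chain F -> relchain G d R} :=
  (\pi_(relchain G d R) \o @boundary n (faces G d) F)%FUN.

Definition rel_homology G d F R : zmodType := coker (Psi G d F R).

End Homology.

Definition has_card (T : Type) (N : nat) : Prop :=
  ([set: T]%classic #= `I_N%classic)%card.

Section Orientations.
Variable n : nat.
Notation face := {set 'I_n}.
Implicit Types (G S F R C : {set face}) (d : nat).

(* A linear ordering of a finite set is its increasing enumeration. *)
Definition linear_ordering S (s : seq face) : Prop := uniq s /\ s =i S.

(* Maps between the finite types of elements of C (= complement of the root)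
   and of F. *)
Definition orientation C F :=
  {ffun {r : face | r \in C} -> {f : face | f \in F}}.

Definition fitting C F (phi : orientation C F) : bool :=
  [&& injectiveb phi,
      [forall f : {f : face | f \in F}, f \in codom phi]
    & [forall r : {r : face | r \in C}, val r \subset val (phi r)]].

(* The permutation sending i to the position in beta of the image of the i-th
   face of alpha. It is unique when alpha and beta are linear orderings and
   phi is bijective; the default value 1 is then never used. *)
Definition ordering_perm C F (alpha beta : seq face) (phi : orientation C F) :
    'S_#|F| :=
  odflt 1%g [pick s : 'S_#|F| |
    [forall i : 'I_#|F|, forall r : {r : face | r \in C},
      (val r == nth set0 alpha i) ==> (val (phi r) == nth set0 beta (s i))]].

Definition lambda C F (alpha beta : seq face) (phi : orientation C F) : int :=
  (-1) ^+ ordering_perm alpha beta phi *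
  \prod_(r : {r : face | r \in C}) incidence (val r) (val (phi r)).

(* For a rooted forest, alpha and beta both have #|F| elements. *)
Definition ordered_mx F (alpha beta : seq face) : 'M[int]_#|F| :=
  \matrix_(i, j) incidence (nth set0 alpha i) (nth set0 beta j).

Definition ordering_sign F (alpha beta : seq face) : int :=
  Num.sg (\det (ordered_mx F alpha beta)).

Definition Lambda C F (alpha beta : seq face) (phi : orientation C F) : int :=
  ordering_sign F alpha beta * lambda alpha beta phi.

End Orientations.

(* Main.v *)
(* By the Leibniz formula, the determinant of the square submatrix M of the
   incidence matrix with rows alpha and columns beta is the sum of lambda over
   all bijections, and the bijections that are not fitting contribute 0; so the
   signed sum is |det M|.  Since the relative homology is Z^m / M Z^m, the
   Smith normal form of M shows that it also has |det M| elements.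
   Reordering alpha or beta by a permutation multiplies both det M and lambda
   by its sign, and these signs cancel in Lambda. *)
Require Import Defs.
From mathcomp Require Import boolp classical_sets cardinality.
From mathcomp Require Import all_boot all_order all_fingroup all_algebra reals.
From mathcomp Require Import generic_quotient.

Set Implicit Arguments.
Unset Strict Implicit.
Unset Printing Implicit Defensive.

Import Order.TTheory GRing.Theory Num.Theory.
Local Open Scope ring_scope.

(** * Index of a full-rank integer lattice *)

Lemma normr_unitz (u : int) : u \is a GRing.unit -> `|u| = 1.
Proof. by case/orP => /eqP ->. Qed.

(** In the Smith form [A = L *m D *m U], multiplying by [invmx U] carries the row lattice of [A] to
    that of the diagonal [D], whose cosets are told apart by the residues of the coordinates modulo
    the entries of [D]. *)
Lemma lattice_index (m : nat) (A : 'M[int]_m) : \det A != 0 ->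
  exists T : finType, #|T|%:Z = `|\det A| /\
    exists g : 'rV[int]_m -> T, (forall t, exists x, g x = t) /\
      (forall x y, g x = g y <-> exists z, x - y = z *m A).
Proof.
case: (int_Smith_normal_form A) => L uL [U uU [d _ defA]] detA.
pose e (i : nat) : int := d`_i; set D := \matrix_(i, j) _ in defA.
have defD : D = diag_mx (\row_i e i).
  by apply/matrixP => i j; rewrite !mxE -val_eqE.
have detE : `|\det A| = \prod_(i < m) `|e i|.
  rewrite defA !det_mulmx !normrM (normr_unitz (u := \det L)) -?unitmxE //.
  rewrite (normr_unitz (u := \det U)) -?unitmxE //.
  rewrite mul1r mulr1 defD det_diag normr_prod.
  by apply: eq_bigr => i _; rewrite mxE.
have d0 (i : 'I_m) : e i != 0.
  rewrite -normr_eq0; apply: contraNneq detA => di0.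
  by rewrite -normr_eq0 detE (bigD1 i) //= di0 mul0r.
have modP (x : int) (i : 'I_m) : (absz (modz x (e i)) < absz (e i))%N.
  by rewrite -ltz_nat !abszE (ger0_norm (modz_ge0 _ _)) ?ltz_mod.
(* One residue per coordinate, each with its own modulus; the diagonal entries may be negative,
   hence [absz]. *)
exists {dffun forall i : 'I_m, 'I_(absz (e i))}; split.
  rewrite detE card_dep_ffun foldrE big_map big_enum /= -[LHS]intz prodMz.
  by apply: eq_bigr => i _; rewrite card_ord intz abszE.
pose c (x : 'rV[int]_m) (i : 'I_m) : int := (x *m invmx U) 0 i.
exists (fun x => [ffun i => Ordinal (modP (c x i) i)]); split.
  move=> t; exists ((\row_i (t i : nat)%:Z) *m U).
  apply/ffunP => i; rewrite ffunE; apply: val_inj => /=.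
  by rewrite /c mulmxK // mxE -modz_abs modz_nat absz_nat modn_small.
move=> x y.
have cB i : c x i - c y i = ((x - y) *m invmx U) 0 i.
  by rewrite mulmxBl [RHS]mxE [X in _ = _ + X]mxE.
split.
  move/ffunP => exy.
  have dvd (i : 'I_m) : (e i %| c x i - c y i)%Z.
    rewrite -eqz_mod_dvd; move: (exy i); rewrite !ffunE => /(congr1 val) /=.
    move/(congr1 Posz); rewrite !abszE !ger0_norm ?modz_ge0 // => ->.
    exact: eqxx.
  (* Solves [z *m L *m D = (x - y) *m invmx U] by coordinatewise division, then cancels [L]. *)
  exists ((\row_i ((c x i - c y i) %/ e i)%Z) *m invmx L).
  apply: (can_inj (mulmxK (_ : invmx U \in unitmx))).
    by rewrite unitmx_inv.
  rewrite defA !mulmxA mulmxKV // mulmxK // defD.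
  apply/rowP => i; rewrite mul_mx_diag [RHS]mxE [X in _ = X * _]mxE.
  rewrite [X in _ = _ * X]mxE divzK // cB.
case=> z exy; apply/ffunP => i; rewrite !ffunE.
apply: val_inj => /=; congr absz.
apply/eqP; rewrite eqz_mod_dvd.
by rewrite cB exy defA !mulmxA mulmxK // defD mul_mx_diag !mxE dvdz_mull.
Qed.

(** * Orderings, permutations and signs of orientations *)

Section Orientations.
Variable n : nat.
Notation face := {set 'I_n}.
Implicit Types (S C F : {set face}) (r f : face).

Lemma incidence_nsubset r f : ~~ (r \subset f) -> incidence r f = 0.
Proof.
rewrite /incidence; case: pickP => // v /andP[_ /eqP->].
by rewrite subsetDl.
Qed.

(** Exactly one vertex of [f] is missing from [r], so the [pick] succeeds and the entry is a power
    of -1. *)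
Lemma incidence_unit r f : r \subset f -> #|f| = #|r|.+1 ->
  incidence r f \is a GRing.unit.
Proof.
move=> rf cf; rewrite /incidence; case: pickP => [v _|no_v].
  by rewrite unitrX ?unitrN1.
have /eqP/cards1P[v fDr] : #|f :\: r| = 1%N.
  by rewrite cardsD (setIidPr rf) cf subSnn.
have vfr : v \in f :\: r by rewrite fDr set11.
case/idP: (no_v v); move: (vfr); rewrite inE => /andP[_ ->] /=.
by rewrite -fDr setDDr setDv set0U (setIidPr rf).
Qed.

(** Serves to reindex sums and products over faces by ordinals. The free [m] lets [C] be enumerated
    by ['I_#|F|]. *)
Lemma ordering_enum S s m : linear_ordering S s -> #|S| = m ->
  exists2 e : 'I_m -> {f : face | f \in S},
    bijective e & forall i, val (e i) = nth set0 s i.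
Proof.
case=> us sS cS.
have szs : size s = m by rewrite -cS -(card_uniqP us); apply: eq_card.
have sP (i : 'I_m) : nth set0 s i \in S by rewrite -sS mem_nth ?szs.
exists (fun i : 'I_m => Sub (nth set0 s i) (sP i)); last first.
  by move=> i; rewrite SubK.
apply: inj_card_bij => [i j /(congr1 val)/eqP|]; last first.
  by rewrite card_sig card_ord cS.
by rewrite !SubK nth_uniq ?szs // => /eqP/val_inj.
Qed.

Variables C F : {set face}.
Notation m := #|F|.

Section Enumerated.
Variables (alpha beta : seq face).
Variables (a : 'I_m -> {r : face | r \in C}) (b : 'I_m -> {f : face | f \in F}).
Hypotheses (aE : forall i, val (a i) = nth set0 alpha i).
Hypotheses (bE : forall i, val (b i) = nth set0 beta i).
Hypotheses (bij_a : bijective a) (bij_b : bijective b).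

(** [s] passes the test of the [pick], so the default is not reached, and injectivity of [b]
    excludes any other candidate. *)
Lemma ordering_permE (phi : orientation C F) (s : 'S_m) :
  (forall i, phi (a i) = b (s i)) -> ordering_perm alpha beta phi = s.
Proof.
move=> phiE; rewrite /ordering_perm; case: pickP => [t|/(_ s)/idP[]] /=.
  move/forallP => tP; apply/permP => i; apply: (bij_inj bij_b).
  rewrite -phiE; apply: val_inj; rewrite bE; apply/esym/eqP.
  by move/forallP/(_ (a i))/implyP: (tP i); apply; rewrite aE.
apply/forallP => i; apply/forallP => r; apply/implyP; rewrite -aE => /eqP.
by move/val_inj->; rewrite phiE bE.
Qed.

Lemma fitting_perm (phi : orientation C F) : fitting phi ->
  forall i, phi (a i) = b (ordering_perm alpha beta phi i).
Proof.
case/and3P => /injectiveP phi_inj _ _.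
have [b' b'K bK] := bij_b.
have s_inj : injective (fun i => b' (phi (a i))).
  by move=> i j /(can_inj bK)/phi_inj/(bij_inj bij_a).
by rewrite (@ordering_permE phi (perm s_inj)) => i; rewrite permE bK.
Qed.

Lemma lambda_enum (phi : orientation C F) (s : 'S_m) :
  (forall i, phi (a i) = b (s i)) ->
  lambda alpha beta phi =
    (-1) ^+ s * \prod_i ordered_mx F alpha beta i (s i).
Proof.
move=> phiE; rewrite /lambda (ordering_permE phiE) (reindex a) /=; last first.
  exact: onW_bij.
by congr (_ * _); apply: eq_bigr => i _; rewrite mxE phiE aE bE.
Qed.

Lemma sum_lambda :
  \sum_(phi : orientation C F | fitting phi) lambda alpha beta phi =
    \det (ordered_mx F alpha beta).
Proof.
have [a' a'K aK] := bij_a; have [b' b'K bK] := bij_b.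
(* [ori] inverts [ordering_perm] on fitting orientations, so these correspond to the [s] with
   [ori s] fitting. *)
pose ori (s : 'S_m) : orientation C F := [ffun r => b (s (a' r))].
have oriE s i : ori s (a i) = b (s i) by rewrite ffunE a'K.
rewrite (reindex_onto ori (ordering_perm alpha beta)) /=; last first.
  by move=> phi /fitting_perm fphi; apply/ffunP => r; rewrite ffunE -fphi aK.
rewrite /determinant [RHS](bigID (fun s => fitting (ori s))) /=.
rewrite [X in _ = _ + X]big1 ?addr0 => [|s nfit].
  apply: eq_big => [s|s _]; last exact: lambda_enum.
  by rewrite (ordering_permE (oriE s)) eqxx andbT.
(* [ori s] is always bijective, so it fails to be fitting only through a missing inclusion, which
   gives a zero factor. *)
suff [i ni] : exists i, ~~ (val (a i) \subset val (b (s i))).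
  by rewrite (bigD1 i) //= mxE -aE -bE incidence_nsubset // mul0r mulr0.
apply/existsP; rewrite -negb_forall; apply: contra nfit => /forallP sub.
apply/and3P; split.
- apply/injectiveP => r r'; rewrite !ffunE.
  by move/(bij_inj bij_b)/perm_inj/(can_inj aK).
- apply/forallP => f; apply/codomP; exists (a (s^-1%g (b' f))).
  by rewrite oriE permKV bK.
- by apply/forallP => r; rewrite ffunE -{1}(aK r).
Qed.

Lemma lambda_unit (phi : orientation C F) k :
  (forall r, r \in C -> #|r| = k) -> (forall f, f \in F -> #|f| = k.+1) ->
  fitting phi -> lambda alpha beta phi \is a GRing.unit.
Proof.
move=> Ck Fk /and3P[_ _ /forallP sub]; rewrite unitrM unitrX ?unitrN1 //=.
rewrite unitr_prod // => r _; apply: incidence_unit (sub r) _.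
by rewrite (Ck _ (valP r)) (Fk _ (valP (phi r))).
Qed.

End Enumerated.

Lemma Lambda_ordering_indep alpha beta alpha' beta' (phi : orientation C F) :
  #|C| = #|F| ->
  linear_ordering C alpha -> linear_ordering F beta ->
  linear_ordering C alpha' -> linear_ordering F beta' ->
  fitting phi -> Lambda alpha beta phi = Lambda alpha' beta' phi.
Proof.
move=> cCF oa ob oa' ob' fphi.
have [a bij_a aE] := ordering_enum oa cCF.
have [b bij_b bE] := ordering_enum ob erefl.
have [a' bij_a' aE'] := ordering_enum oa' cCF.
have [b' bij_b' bE'] := ordering_enum ob' erefl.
have [ai aiK aK] := bij_a; have [bi biK bK] := bij_b.
(* [s] and [t] will turn positions in the new orderings into positions in the old ones. *)
have s_inj : injective (ai \o a').
  exact: inj_comp (can_inj aK) (bij_inj bij_a').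
have t_inj : injective (bi \o b').
  exact: inj_comp (can_inj bK) (bij_inj bij_b').
set s := perm s_inj; set t := perm t_inj.
have a'E i : a' i = a (s i) by rewrite permE /= aK.
have b'E i : b' i = b (t i) by rewrite permE /= bK.
have ordE : ordered_mx F alpha' beta' =
    row_perm s (col_perm t (ordered_mx F alpha beta)).
  by apply/matrixP => i j; rewrite !mxE -aE -aE' -bE -bE' a'E b'E.
set p := ordering_perm alpha beta phi.
(* Permutation products act from left to right: to an old position by [s], across by [p], back to a
   new position by [t^-1]. *)
have p'E i : phi (a' i) = b' ((s * p * t^-1)%g i).
  by rewrite a'E (fitting_perm aE bE bij_a bij_b fphi) b'E !permM permKV.
rewrite /Lambda /ordering_sign ordE row_permE col_permE !det_mulmx !det_perm.
rewrite (lambda_enum aE' bE' bij_a' bij_b' p'E).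
rewrite (lambda_enum aE bE bij_a bij_b (fitting_perm aE bE bij_a bij_b fphi)).
rewrite -/p !sgrM !sgrX sgrN1.
have -> : \prod_i ordered_mx F alpha' beta' i ((s * p * t^-1)%g i) =
    \prod_i ordered_mx F alpha beta i (p i).
  rewrite [RHS](reindex_inj (@perm_inj _ s)) /=.
  by apply: eq_bigr => i _; rewrite ordE !mxE !permM permKV.
rewrite !odd_permM odd_permV.
case: (odd_perm s) (odd_perm t) (odd_perm p) => [] [] [] /=;
  rewrite ?(expr0, expr1, mulN1r, mul1r, mulr1, mulrN1, mulrN, mulNr, opprK) //.
Qed.

End Orientations.

(** * Rank and relative homology of a rooted forest *)

Lemma row_free_rowsub1 (K : fieldType) m p (f : 'I_m -> 'I_p) :
  injective f -> row_free (rowsub f (1%:M : 'M[K]_p)).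
Proof.
move=> f_inj; apply/row_freeP; exists (colsub f 1%:M).
rewrite mul_rowsub_mx mul1mx; apply/matrixP => i j.
by rewrite !mxE (inj_eq f_inj).
Qed.

Lemma row_freeM (K : fieldType) m p q (A : 'M[K]_(m, p)) (B : 'M[K]_(p, q)) :
  row_free A -> row_free B -> row_free (A *m B).
Proof. by move=> fA fB; rewrite /row_free mxrankMfree. Qed.

Section RootedForest.
Variables (K : realType) (n d : nat) (G F R : {set {set 'I_n}}).
Hypothesis hFR : rooted_forest K G d F R.
Notation C := (coroot G d R).

(** Both sides are the rank over [K] of [bdmx (faces G d) F]: its columns are independent, and its
    rows in [C] are a basis of the row space. *)
Lemma card_coroot : #|C| = #|F|.
Proof.
case: hFR => [[_ freeF] [_ freeC spanC]].
rewrite -(eqP freeC) (eqmx_rank spanC).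
by rewrite -mxrank_tr (eqP freeF).
Qed.

Lemma det_ordered_neq0 alpha beta :
  linear_ordering C alpha -> linear_ordering F beta ->
  \det (ordered_mx F alpha beta) != 0.
Proof.
move=> oa ob.
have [a bij_a aE] := ordering_enum oa card_coroot.
have [b bij_b bE] := ordering_enum ob erefl.
case: hFR => [_ [_ freeC _]].
pose f i := enum_rank_in (valP (a i)) (val (a i)).
pose g i := enum_rank_in (valP (b i)) (val (b i)).
have fE i : enum_val (f i) = val (a i) by rewrite enum_rankK_in ?(valP (a i)).
have gE i : enum_val (g i) = val (b i) by rewrite enum_rankK_in ?(valP (b i)).
have f_inj : injective f.
  by move=> i j /(congr1 enum_val); rewrite !fE => /val_inj/(bij_inj bij_a).
have g_inj : injective g.
  by move=> i j /(congr1 enum_val); rewrite !gE => /val_inj/(bij_inj bij_b).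
(* Passing from the order of [enum] to [alpha] and [beta] multiplies by selection matrices, which
   preserve row freeness. *)
have eqM : map_mx intr (ordered_mx F alpha beta) =
    rowsub f 1%:M *m (map_mx intr (bdmx C F) : 'M[K]__) *m
      (rowsub g 1%:M)^T.
  rewrite mul_rowsub_mx mul1mx trmx_mxsub trmx1 mulmx_colsub mulmx1.
  by apply/matrixP => i j; rewrite !mxE fE gE aE bE.
have free_g : row_free (rowsub g 1%:M : 'M[K]_#|F|)^T.
  by rewrite row_free_unit unitmx_tr -row_free_unit row_free_rowsub1.
have : map_mx intr (ordered_mx F alpha beta) \in @unitmx K #|F|.
  by rewrite -row_free_unit eqM !row_freeM // row_free_rowsub1.
by rewrite unitmxE det_map_mx unitfE intr_eq0.
Qed.

(** Restriction to the coordinates in [C] kills exactly the chains on [R] and turns the boundary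
    into multiplication by a matrix, transposed since chains become row vectors; [lattice_index]
    then counts the cosets. *)
Lemma card_rel_homology alpha beta :
  linear_ordering C alpha -> linear_ordering F beta ->
  has_card (rel_homology G d F R) `|\det (ordered_mx F alpha beta)|%N.
Proof.
move=> oa ob.
have [a bij_a aE] := ordering_enum oa card_coroot.
have [b bij_b bE] := ordering_enum ob erefl.
set A := ordered_mx F alpha beta.
have detA : \det A^T != 0 by rewrite det_tr det_ordered_neq0.
have [T [cardT [g [g_surj gP]]]] := lattice_index detA.
have a_face i : val (a i) \in faces G d.
  by have := valP (a i); rewrite inE => /andP[].
pose e i : {r : {set 'I_n} | r \in faces G d} := Sub (val (a i)) (a_face i).
pose res (x : chain (faces G d)) : 'rV[int]_#|F| := \row_i x (e i).
have resB : {morph res : x y / x - y}.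
  by move=> x y; apply/rowP => i; rewrite !mxE !ffunE.
have res_bd (z : chain F) :
    res (boundary (faces G d) z) = (\row_i z (b i)) *m A^T.
  apply/rowP => i; rewrite !mxE !ffunE (reindex b) /=; last exact: onW_bij.
  by apply: eq_bigr => j _; rewrite !mxE -aE -bE.
have res_eq0 x : (x \in subchain (S := faces G d) R) = (res x == 0).
  apply/forallP/eqP => [x0|x0 r].
    apply/rowP => i; rewrite !mxE; apply/eqP/(implyP (x0 _)) => /=.
    by have := valP (a i); rewrite inE => /andP[].
  apply/implyP => rR; have rC : val r \in C by rewrite inE rR (valP r).
  have [ai aiK aK] := bij_a.
  have -> : r = e (ai (Sub (val r) rC)) by apply: val_inj; rewrite /= aK.
  by move/rowP/(_ (ai (Sub (val r) rC))): x0; rewrite !mxE => ->.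
pose q (x : chain (faces G d)) : rel_homology G d F R :=
  \pi_(rel_homology G d F R)%qT (\pi_(relchain G d R)%qT x).
(* The outer quotient supplies a chain [z] on [F]; the inner one says that the remaining difference
   restricts to zero. *)
have qP x y : q x = q y <-> g (res x) = g (res y).
  rewrite gP -resB; split.
    move=> /eqP; rewrite -Quotient.idealrBE => /asboolP[z /eqP].
    rewrite -raddfB /=.
    rewrite -Quotient.idealrBE res_eq0 resB res_bd subr_eq0 => /eqP->.
    by exists (\row_i z (b i)).
  case=> z xyE; have [bi biK bK] := bij_b; apply/eqP.
  rewrite -Quotient.idealrBE; apply/asboolP.
  exists [ffun f => z 0 (bi f)]; apply/eqP; rewrite -raddfB /=.
  rewrite -Quotient.idealrBE res_eq0 resB res_bd xyE subr_eq0.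
  by apply/eqP; congr (_ *m _); apply/rowP => i; rewrite !mxE ffunE biK.
(* One [repr] for each of the two nested quotients; by [qP] the choice does not affect the value. *)
pose h (t : rel_homology G d F R) : T := g (res (repr (repr t))).
have qK t : q (repr (repr t)) = t by rewrite /q !reprK.
have -> : `|\det A|%N = #|T|.
  by apply/eqP; rewrite -eqz_nat cardT det_tr abszE.
apply/card_set_bijP; exists (fun t => enum_rank (h t) : nat).
split => [t _|t u _ _|i].
- exact: ltn_ord.
- by move=> /val_inj/enum_rank_inj/qP; rewrite !qK.
- move=> /= ltiT; have [x gx] := g_surj (enum_val (Ordinal ltiT)).
  (* [x] extended by zero to the faces in [R]. *)
  pose x' : chain (faces G d) :=
    [ffun r => if [pick i | e i == r] is Some i then x 0 i else 0].
  have resx' : res x' = x.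
    apply/rowP => j; rewrite !mxE ffunE; case: pickP => [k|/(_ j)]; last first.
      by rewrite eqxx.
    by move=> /eqP/(congr1 val)/= /val_inj/(bij_inj bij_a)->.
  exists (q x') => //=; have /qP := qK (q x'); rewrite -/(h _) resx' gx => ->.
  by rewrite enum_valK.
Qed.

End RootedForest.

Theorem proposition30 (K : realType) (n d : nat) (G F R : {set {set 'I_n}})
    (hG : simplicial_complex G) (hd : has_dimension G d)
    (hFR : rooted_forest K G d F R) :
  (forall alpha beta : seq {set 'I_n},
     linear_ordering (coroot G d R) alpha -> linear_ordering F beta ->
     exists2 N : nat, has_card (rel_homology G d F R) N &
       \sum_(phi : orientation (coroot G d R) F | fitting phi)
         Lambda alpha beta phi = N%:Z)
  /\
  (forall phi : orientation (coroot G d R) F, fitting phi ->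
     (forall alpha beta : seq {set 'I_n},
        linear_ordering (coroot G d R) alpha -> linear_ordering F beta ->
        Lambda alpha beta phi = -1 \/ Lambda alpha beta phi = 1) /\
     (forall alpha beta alpha' beta' : seq {set 'I_n},
        linear_ordering (coroot G d R) alpha -> linear_ordering F beta ->
        linear_ordering (coroot G d R) alpha' -> linear_ordering F beta' ->
        Lambda alpha beta phi = Lambda alpha' beta' phi)).
Proof.
have cC := card_coroot hFR.
(* The integer units are 1 and -1. Faces of the coroot have [d] vertices and those of [F] have
   [d.+1], so each incidence along [phi] is a unit. *)
have unit_lambda alpha beta phi :
    fitting phi -> lambda (C := coroot G d R) (F := F) alpha beta phi
      \is a GRing.unit.
  apply: (@lambda_unit _ _ _ alpha beta phi d) => [r|f fF].
    by rewrite !inE => /and3P[_ _ /eqP].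
  have [[/fintype.subsetP/(_ f fF) + _] _] := hFR.
  by rewrite inE => /andP[_ /eqP].
split=> [alpha beta oa ob|phi fphi]; last split.
- exists `|\det (ordered_mx F alpha beta)|%N.
    exact: (card_rel_homology hFR oa ob).
  have [a bij_a aE] := ordering_enum oa cC.
  have [b bij_b bE] := ordering_enum ob erefl.
  by rewrite -mulr_sumr (sum_lambda aE bE bij_a bij_b) abszE normrEsg.
- move=> alpha beta oa ob.
  have : Lambda alpha beta phi \is a GRing.unit.
    rewrite unitrM unit_lambda // andbT /ordering_sign.
    by rewrite -neqr0_sign ?unitrX ?unitrN1 ?(det_ordered_neq0 hFR).
  by case/orP => /eqP ->; [right | left].
- by move=> *; apply: Lambda_ordering_indep.
Qed.
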